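(* Let $X$ be an aligned interval. Then there is an interval $Y$ with $\mathrm{span}(Y)=4\,\mathrm{span}(X)$ such that $Z\subseteq Y$ for every interval $Z$ with $\mathrm{align}(Z)\subseteq X$.
   Context: Intervals are closed real intervals of positive length; $\mathrm{span}(X)$ is the length of $X$. An interval is aligned iff it equals $[a2^{k},(a+1)2^{k}]$ for some integers $k,a$. For an interval $Z$, $\mathrm{align}(Z)$ denotes some largest (longest) aligned interval contained in $Z$. *)

(* Defs.v *)
From HB Require Import structures.
From mathcomp Require Import all_boot all_order all_algebra.
From mathcomp Require Import all_classical all_reals.
From mathcomp Require Import lra zify.

Set Implicit Arguments.
Unset Strict Implicit.
Unset Printing Implicit Defensive.

Import Order.TTheory GRing.Theory Num.Theory.

Local Open Scope classical_set_scope.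
Local Open Scope ring_scope.

(* A closed real interval of positive length; MathComp's [interval R] would
   also admit empty, degenerate, open and unbounded intervals. *)
Record rinterval (R : realType) := RInterval {
  lo : R;
  hi : R;
  lo_lt_hi : lo < hi }.

Definition rinterval_set (R : realType) (X : rinterval R) : set R :=
  `[lo X, hi X].

Coercion rinterval_set : rinterval >-> set.

Definition rspan (R : realType) (X : rinterval R) : R := hi X - lo X.

(* The exponent k ranges over all of int: 2 ^ k is [exprz]. *)
Definition aligned (R : realType) (X : rinterval R) : Prop :=
  exists k a : int, lo X = a%:~R * 2 ^ k /\ hi X = (a + 1)%:~R * 2 ^ k.

Definition is_largest_aligned (R : realType) (Z A : rinterval R) : Prop :=
  [/\ aligned A, A `<=` Z &
      forall B : rinterval R, aligned B -> B `<=` Z -> rspan B <= rspan A].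

(* A largest aligned subinterval need not be unique, so "align" stands for any
   function selecting one for each interval. *)
Definition is_align (R : realType) (align : rinterval R -> rinterval R) : Prop :=
  forall Z : rinterval R, is_largest_aligned Z (align Z).

Lemma rinterval_subset (R : realType) (A B : rinterval R) :
  A `<=` B <-> lo B <= lo A /\ hi A <= hi B.
Proof.
split=> [AB|[BA AB] x].
  have h := ltW (lo_lt_hi A).
  have := AB (lo A); have := AB (hi A).
  rewrite /rinterval_set /= !in_itv /= !lexx h => /(_ isT) /andP[_ ->].
  by move=> /(_ isT) /andP[->].
rewrite /rinterval_set /= !in_itv /= => /andP[Ax xA].
by rewrite (le_trans BA Ax) (le_trans xA AB).
Qed.

(* Such functions exist, so quantifying over them is not vacuous. *)
Lemma align_exists (R : realType) :
  exists align : rinterval R -> rinterval R, is_align align.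
Proof.
suff /choice[f fP] : forall Z : rinterval R, exists A, is_largest_aligned Z A.
  by exists f.
move=> Z.
have e2 k : 0 < 2 ^ k :> R by rewrite exprz_gt0.
pose P (k : int) := exists a : int,
  lo Z <= a%:~R * 2 ^ k /\ (a + 1)%:~R * 2 ^ k <= hi Z.
have P_exists : exists k, P k.
  have L0 : 0 < hi Z - lo Z by rewrite subr_gt0 lo_lt_hi.
  pose n := Num.bound (2 / (hi Z - lo Z)).
  have hn : 2 / (hi Z - lo Z) < 2 ^ n%:Z.
    apply: lt_le_trans (archi_boundP _) _; first by rewrite divr_ge0 // ltW.
    by rewrite -exprnP -natrX ler_nat ltnW // ltn_expl.
  have hn2 : 2 * 2 ^ (- n%:Z) < hi Z - lo Z.
    by rewrite -invr_expz ltr_pdivrMr // mulrC -ltr_pdivrMr.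
  exists (- n%:Z), (Num.ceil (lo Z / 2 ^ (- n%:Z))).
  have e0 := e2 (- n%:Z).
  set e := 2 ^ (- n%:Z) in hn2 e0 *.
  have /andP[c1 c2] := ceil_itv (lo Z / e).
  set c := Num.ceil _ in c1 c2 *.
  rewrite intrB in c1; rewrite intrD.
  rewrite ltr_pdivlMr // in c1; rewrite ler_pdivrMr // in c2.
  by split=> //; lra.
have P_bound : exists N : nat, forall k, P k -> k <= N%:Z.
  exists (Num.bound (hi Z - lo Z)) => k [a [ak ka]].
  rewrite leNgt; apply/negP => hk.
  have L0 : 0 <= hi Z - lo Z by rewrite subr_ge0 ltW ?lo_lt_hi.
  have := archi_boundP L0; set N := Num.bound _ in hk *.
  apply/negP; rewrite -leNgt.
  have : 2 ^ k <= hi Z - lo Z.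
    by rewrite intrD mulrDl mul1r in ka; lra.
  apply: le_trans; apply: le_trans (_ : 2 ^ N%:Z <= _).
    by rewrite -exprnP -natrX ler_nat ltnW // ltn_expl.
  by rewrite ler_eXz2l ?ltr1n // ltW.
have [k [[a [ak ka]] kmax]] : exists k, P k /\ forall j, P j -> j <= k.
  have [N hN] := P_bound; have [k0 Pk0] := P_exists.
  have [m] : exists m : nat, N%:Z <= k0 + m%:Z by exists `|N%:Z - k0|%N; lia.
  elim: m k0 Pk0 => [|m IH] k Pk hk.
    by exists k; split=> // j /hN; lia.
  have [[j [Pj kj]]|nj] := pselect (exists j, P j /\ k < j).
    by apply: (IH j) => //; lia.
  exists k; split=> // j Pj; rewrite leNgt; apply/negP => kj.
  by apply: nj; exists j.
have lt_ak : a%:~R * 2 ^ k < (a + 1)%:~R * 2 ^ k :> R.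
  by rewrite ltr_pM2r // ltr_int; lia.
exists (RInterval lt_ak); split.
- by exists k, a.
- by apply/rinterval_subset.
move=> B [j [b [Bl Bh]]] /rinterval_subset[]; rewrite Bl Bh => bj jb.
have unit_span (c i : int) : (c + 1)%:~R * 2 ^ i - c%:~R * 2 ^ i = 2 ^ i :> R.
  by rewrite -mulrBl intrD addrAC subrr add0r mul1r.
by rewrite /rspan /= Bl Bh !unit_span ler_eXz2l ?ltr1n // kmax //; exists b.
Qed.

(* Main.v *)
Require Import Defs.
From HB Require Import structures.
From mathcomp Require Import all_boot all_order all_algebra.
From mathcomp Require Import all_classical all_reals.
From mathcomp Require Import lra zify.

Set Implicit Arguments.
Unset Strict Implicit.
Unset Printing Implicit Defensive.

Import Order.TTheory GRing.Theory Num.Theory.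

Local Open Scope classical_set_scope.
Local Open Scope ring_scope.

(** Exactly one endpoint [q] of an aligned interval [X] of span [2^k] is a
    multiple of [2^(k+1)]; take [Y = [q - 2^(k+1), q + 2^(k+1)]].  If
    [align Z = X] and [Z] left [Y], then [Z] would contain one of the two
    aligned halves of [Y], which are longer than [X].  If [align Z] is shorter
    than [X], then its span is at most [2^(k-1)], so by the same argument [Z]
    exceeds it, hence also [X], by at most [2^k] on each side; and [Y] extends
    [X] by at least [2^k] on each side. *)

(** One of the consecutive integers [a] and [a + 1] is even, and [p] is its half. *)
Lemma aligned_even_endpoint (R : realType) (A : rinterval R) : aligned A ->
  exists k p : int, rspan A = 2 ^ k /\
    (lo A = p%:~R * 2 ^ (k + 1) \/ hi A = p%:~R * 2 ^ (k + 1)).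
Proof.
move=> [k [a [loA hiA]]]; exists k.
have [p ap] : exists p : int, a = p + p \/ a + 1 = p + p.
  have [|] := boolP ((2 %| a)%Z).
    by move=> a2; exists (a %/ 2)%Z; left; lia.
  by move=> a2; exists ((a %/ 2)%Z + 1); right; lia.
have p2 : p%:~R * 2 ^ (k + 1) = (p + p)%:~R * 2 ^ k :> R.
  by rewrite expfzDr ?pnatr_eq0 // expr1z intrD; lra.
exists p; split; first by rewrite /rspan loA hiA intrD; lra.
by rewrite p2 loA hiA; case: ap => ->; [left|right].
Qed.

(** The cell from [a * 2 ^ k] to [(a + 1) * 2 ^ k] would be an aligned subinterval of [Z] longer
    than [A]. *)
Lemma no_longer_aligned (R : realType) (Z A : rinterval R) (k a : int) :
  is_largest_aligned Z A -> rspan A < 2 ^ k ->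
  lo Z <= a%:~R * 2 ^ k -> (a + 1)%:~R * 2 ^ k <= hi Z -> False.
Proof.
move=> [_ _ Amax] Ak Za aZ.
have aa : a%:~R * 2 ^ k < (a + 1)%:~R * 2 ^ k :> R.
  by rewrite ltr_pM2r ?exprz_gt0 // ltr_int; lia.
have := Amax (RInterval aa); rewrite /rspan /= in Ak *.
have -> : (a + 1)%:~R * 2 ^ k - a%:~R * 2 ^ k = 2 ^ k :> R by rewrite intrD; lra.
move=> /(_ (ex_intro _ k (ex_intro _ a (conj erefl erefl)))).
have /[swap]/[apply] : RInterval aa `<=` Z by apply/rinterval_subset.
by rewrite leNgt Ak.
Qed.

(** Leaving the ball on the left or right, [Z] would contain the whole grid cell numbered [p - 1] or
    [p], respectively. *)
Lemma largest_aligned_ball (R : realType) (Z A : rinterval R) (k p : int) :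
  is_largest_aligned Z A -> rspan A < 2 ^ k ->
  lo Z <= p%:~R * 2 ^ k <= hi Z ->
  p%:~R * 2 ^ k - 2 ^ k <= lo Z /\ hi Z <= p%:~R * 2 ^ k + 2 ^ k.
Proof.
move=> largeA Ak /andP[Zp pZ].
split; rewrite leNgt; apply/negP => out.
  apply: (no_longer_aligned (a := p - 1) largeA Ak); last by rewrite subrK.
  by rewrite intrB; lra.
apply: (no_longer_aligned (a := p) largeA Ak) => //.
by rewrite intrD; lra.
Qed.

Theorem mainTheorem7 (R : realType) (align : rinterval R -> rinterval R)
    (align_spec : is_align align) (X : rinterval R) (X_aligned : aligned X) :
  exists Y : rinterval R,
    rspan Y = 4 * rspan X /\
    forall Z : rinterval R, align Z `<=` X -> Z `<=` Y.
Proof.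
have [k [p [spanX]]] := aligned_even_endpoint X_aligned.
have e2 j : 2 ^ (j + 1) = 2 * 2 ^ j :> R.
  by rewrite expfzDr ?pnatr_eq0 // expr1z mulrC.
have e0 j : 0 < 2 ^ j :> R by rewrite exprz_gt0.
set q : R := p%:~R * 2 ^ (k + 1) => qX.
have ltY : q - 2 ^ (k + 1) < q + 2 ^ (k + 1) by have := e0 (k + 1); lra.
exists (RInterval ltY); split; first by rewrite /rspan /= in spanX *; have := e2 k; lra.
move=> Z /rinterval_subset[XA AX]; apply/rinterval_subset => /=.
have largeA := align_spec Z.
have [alA /rinterval_subset[ZA AZ] _] := largeA.
have [j [r [spanA]]] := aligned_even_endpoint alA.
set s : R := r%:~R * 2 ^ (j + 1) => sA.
have ej := e0 j; have ek := e0 k; have e2j := e2 j; have e2k := e2 k.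
have ltA := lo_lt_hi (align Z).
have [kj|jk] := leP k j.
  (* As [align Z] lies in [X], the two intervals coincide here, so [q] is a point of [Z]. *)
  have le_kj : 2 ^ k <= 2 ^ j :> R by rewrite ler_eXz2l // ltr1n.
  rewrite /rspan in spanX spanA.
  apply: (largest_aligned_ball largeA); first by rewrite /rspan; lra.
  by rewrite -/q; apply/andP; split; case: qX => qX; lra.
(* The ball is now centred at [s], a point of [X], and its radius [2 ^ (j + 1)] is at most [2 ^ k],
   the smaller of the two margins of [Y] around [X]. *)
have le_jk : 2 ^ (j + 1) <= 2 ^ k :> R by rewrite ler_eXz2l ?ltr1n //; lia.
have [||] := largest_aligned_ball (k := j + 1) (p := r) largeA; rewrite -/s.
- by rewrite spanA; lra.
- by apply/andP; split; case: sA => sA; lra.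
rewrite /rspan in spanX spanA.
by split; case: qX => qX; case: sA => sA; lra.
Qed.
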